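(* For $1\le i\le 8$ let $C_i^{(\mathrm{N1})}=V(Q^{(\mathrm{N1})},P_i^{(\mathrm{N1})})\subset\mathbb{P}^3$ be the superspecial curve of genus $4$ over $\mathbb{F}_{11}$ defined by $Q^{(\mathrm{N1})}=2xw+2yz$ and the cubic form $P_i^{(\mathrm{N1})}$ listed in the context. Then the following hold, where matrices over $\mathbb{F}_{11}$ denote the automorphisms they represent (modulo scalars). (1) $\operatorname{Aut}_{\mathbb{F}_{11}}(C_1^{(\mathrm{N1})})$ has order $6$ and is generated by $\begin{pmatrix}2&4&5&1\\3&6&5&1\\7&7&1&10\\6&6&10&1\end{pmatrix}$. (2) $\operatorname{Aut}_{\mathbb{F}_{11}}(C_2^{(\mathrm{N1})})$ has order $2$ and is generated by $\operatorname{diag}(-1,1,1,-1)$. (3) $\operatorname{Aut}_{\mathbb{F}_{11}}(C_3^{(\mathrm{N1})})$ has order $8$ and is generated by $\begin{pmatrix}5&6&6&6\\5&6&5&5\\5&5&6&5\\6&6&6&5\end{pmatrix}$ and $\operatorname{diag}(-1,1,1,-1)$, whose orders are $4$ and $2$ respectively. (4) $\operatorname{Aut}_{\mathbb{F}_{11}}(C_4^{(\mathrm{N1})})$ has order $2$ and is generated by $\begin{pmatrix}10&6&6&3\\10&1&6&6\\2&10&1&6\\9&2&10&10\end{pmatrix}$. (5) $\operatorname{Aut}_{\mathbb{F}_{11}}(C_5^{(\mathrm{N1})})$ has order $3$ and is generated by $\begin{pmatrix}5&7&3&9\\8&7&7&9\\10&3&0&0\\6&8&0&0\end{pmatrix}$.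 (6) $\operatorname{Aut}_{\mathbb{F}_{11}}(C_6^{(\mathrm{N1})})$ has order $4$ and is generated by $\begin{pmatrix}2&3&10&7\\1&9&5&10\\5&2&9&3\\3&5&1&2\end{pmatrix}$ and $\begin{pmatrix}1&5&6&3\\0&0&1&6\\0&1&0&5\\0&0&0&1\end{pmatrix}$, whose orders are $2$ and $2$ respectively. (7) $\operatorname{Aut}_{\mathbb{F}_{11}}(C_7^{(\mathrm{N1})})$ has order $12$ and is generated by $\begin{pmatrix}6&3&5&3\\1&6&1&5\\5&3&6&3\\1&5&1&6\end{pmatrix}$ and $\begin{pmatrix}0&6&0&10\\0&8&0&7\\1&0&2&0\\6&0&3&0\end{pmatrix}$, whose orders are $2$ and $6$ respectively. (8) $\operatorname{Aut}_{\mathbb{F}_{11}}(C_8^{(\mathrm{N1})})$ has order $24$ and is generated by $\begin{pmatrix}0&0&5&2\\7&6&9&8\\0&0&8&9\\2&6&1&8\end{pmatrix}$ and $\begin{pmatrix}9&5&2&5\\1&3&3&2\\8&5&3&5\\4&8&1&9\end{pmatrix}$, whose orders are $4$ and $2$ respectively.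
   Context: The cubic forms in $\mathbb{F}_{11}[x,y,z,w]$ are: $P_1^{(\mathrm{N1})}=x^2y+x^2z+2y^2z+5y^2w+9yz^2+yzw+4z^3+3z^2w+10zw^2+w^3$, $P_2^{(\mathrm{N1})}=x^2y+x^2z+y^3+y^2z+7yz^2+4yw^2+2z^3+9zw^2$, $P_3^{(\mathrm{N1})}=x^2y+x^2z+y^3+8y^2z+3yz^2+10yw^2+10z^3+10zw^2$, $P_4^{(\mathrm{N1})}=x^2y+x^2z+y^3+9y^2z+2y^2w+3yz^2+3yzw+4yw^2+10z^3+2z^2w+6zw^2$, $P_5^{(\mathrm{N1})}=x^2y+x^2z+xz^2+10y^2w+9yz^2+9yw^2+8z^3+8z^2w+8zw^2+3w^3$, $P_6^{(\mathrm{N1})}=x^2y+x^2z+xz^2+9y^2z+5y^2w+yzw+8yw^2+3z^3+9z^2w+2zw^2+5w^3$, $P_7^{(\mathrm{N1})}=x^2y+x^2z+xz^2+4y^3+2y^2z+10y^2w+3yz^2+8yzw+8yw^2+8z^3+7z^2w+7zw^2+4w^3$, $P_8^{(\mathrm{N1})}=x^2y+x^2z+xz^2+9y^3+6y^2z+5y^2w+8yz^2+5yzw+2yw^2+z^3+2z^2w+7zw^2+w^3$. These curves are known to be nonsingular nonhyperelliptic superspecial curves of genus $4$ (canonically embedded). For $C=V(Q,P)$ over a field $K$, $\operatorname{Aut}_K(C)$ is the group of automorphisms of $C$ defined over $K$. It is described as $\operatorname{Aut}_K(C)=G_K/{\sim}$, where, with $\varphi$ the symmetric coefficient matrix of $Q$,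 $G_K=\{g\in \mathrm{GL}_4(K): {}^tg\varphi g=\mu\varphi\text{ for some }\mu\in K^\times,\ g\cdot P\equiv rP \bmod Q\text{ for some } r\in K^\times\}$, $g\cdot P:=P((x,y,z,w)\cdot{}^tg)$, and $g\sim cg$ for $c\in K^\times$. Generators are given by matrices representing classes in $G_K/{\sim}$, and orders are those of the classes. *)

(* Defs.v *)
From HB Require Import structures.
From mathcomp Require Import all_boot all_order all_algebra all_fingroup.
From mathcomp Require Import boolp ring.
From mathcomp Require Import mpoly.

Set Implicit Arguments.
Unset Strict Implicit.
Unset Printing Implicit Defensive.

Import GRing.Theory.

Local Open Scope ring_scope.

Section Automorphisms.

Variable K : finFieldType.
Implicit Types (Q P : {mpoly K[4]}) (g : 'M[K]_4).

(* For a quadratic form Q in characteristic different from 2, this is the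
   symmetric matrix phi with Q = \sum_(i, j) phi i j *: ('X_i * 'X_j). *)
Definition coefmx Q : 'M[K]_4 :=
  \matrix_(i, j) (if i == j then Q@_(U_(i) + U_(j)) else Q@_(U_(i) + U_(j)) / 2).

(* g . P = P((x, y, z, w) * g^T): the variable 'X_i is replaced by the i-th
   coordinate of g applied to the column of variables. *)
Definition lsubst g P : {mpoly K[4]} :=
  P \mPo [tuple \sum_j g i j *: 'X_j | i < 4].

Definition preserves Q P g : Prop :=
  (exists2 mu : K, mu != 0 & g^T *m coefmx Q *m g = mu *: coefmx Q) /\
  (exists2 r : K, r != 0 &
     exists h : {mpoly K[4]}, lsubst g P = r *: P + h * Q).

Definition GK Q P : {set {'GL_4[K]}} :=
  [set g : {'GL_4[K]} | `[< preserves Q P (GLval g) >]].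

Definition scalarGL : {set {'GL_4[K]}} :=
  [set g : {'GL_4[K]} | [exists c : K, GLval g == c%:M]].

Lemma scalarGL_group_set : group_set scalarGL.
Proof.
apply/group_setP; split=> [|g h]; rewrite !inE.
  by apply/existsP; exists 1; rewrite GL_1E.
move=> /existsP[c /eqP gc] /existsP[d /eqP hd]; apply/existsP; exists (c * d).
by rewrite GL_ME gc hd -mulmxE -scalar_mxM.
Qed.
Canonical scalarGL_group := Group scalarGL_group_set.

Lemma norm_scalarGL (A : {set {'GL_4[K]}}) : (A \subset 'N(scalarGL))%g.
Proof.
apply: cents_norm; apply/centsP => g _ h; rewrite inE => /existsP[c /eqP hc].
apply/val_inj; change (GLval (g * h) = GLval (h * g)).
by rewrite !GL_ME hc -!mulmxE scalar_mxC.
Qed.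

(* Since scalarGL is central, the mathcomp quotient (the image of
   GK :&: 'N(scalarGL)) is the whole set of classes g ~ c *: g. *)
Definition AutK Q P : {set coset_of scalarGL} := (GK Q P / scalarGL)%g.

Definition represents Q P g (a : coset_of scalarGL) : Prop :=
  exists u : {'GL_4[K]}, [/\ u \in GK Q P, GLval u = g & coset scalarGL u = a].

Definition mx4 (s : seq (seq K)) : 'M[K]_4 := \matrix_(i, j) (nth [::] s i)`_j.

Definition diag4 (s : seq K) : 'M[K]_4 := diag_mx (\row_j s`_j).

Definition qform (A : 'M[K]_4) : {mpoly K[4]} :=
  \sum_i \sum_j A i j *: ('X_i * 'X_j).

Lemma lsubstX g i : lsubst g 'X_i = \sum_j g i j *: 'X_j.
Proof. by rewrite /lsubst comp_mpolyXU -tnth_nth tnth_mktuple. Qed.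

Lemma lsubstM g P1 P2 : lsubst g (P1 * P2) = lsubst g P1 * lsubst g P2.
Proof. exact: rmorphM. Qed.

Lemma lsubst_comp g1 g2 P : lsubst (g1 *m g2) P = lsubst g2 (lsubst g1 P).
Proof.
rewrite /lsubst !(comp_mpolyEX P) raddf_sum /=.
apply: eq_bigr => m _; rewrite comp_mpolyZ; congr (_ *: _).
rewrite !comp_mpolyX rmorph_prod /=.
apply: eq_bigr => i _; rewrite rmorphXn /=; congr (_ ^+ _).
rewrite !tnth_mktuple raddf_sum /=.
rewrite [RHS](eq_bigr (fun j => \sum_k (g1 i j * g2 j k) *: 'X_k)).
  rewrite exchange_big /=; apply: eq_bigr => k _.
  by rewrite mxE scaler_suml.
move=> j _; rewrite comp_mpolyZ -/(lsubst g2 _) lsubstX scaler_sumr.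
by apply: eq_bigr => k _; rewrite scalerA.
Qed.

Lemma lsubst1 P : lsubst 1%:M P = P.
Proof.
rewrite /lsubst -[RHS]comp_mpoly_id; congr (_ \mPo _).
apply: eq_from_tnth => i; rewrite !tnth_mktuple (bigD1 i) //= !mxE eqxx scale1r.
by rewrite big1 ?addr0 // => j ji; rewrite mxE eq_sym (negPf ji) scale0r.
Qed.

Lemma qformZ c A : qform (c *: A) = c *: qform A.
Proof.
rewrite /qform scaler_sumr; apply: eq_bigr => i _; rewrite scaler_sumr.
by apply: eq_bigr => j _; rewrite mxE scalerA.
Qed.

Lemma lsubst_qform g A : lsubst g (qform A) = qform (g^T *m A *m g).
Proof.
rewrite /qform {1}/lsubst raddf_sum /=.
transitivity (\sum_i \sum_j \sum_k \sum_l
   (g k i * A k l * g l j) *: ('X_i * 'X_j : {mpoly K[4]})).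
  rewrite (eq_bigr (fun k => \sum_l \sum_i \sum_j
     (g k i * A k l * g l j) *: ('X_i * 'X_j : {mpoly K[4]}))).
    rewrite [LHS](eq_bigr (fun k => \sum_i \sum_j \sum_l
       (g k i * A k l * g l j) *: ('X_i * 'X_j : {mpoly K[4]}))); last first.
      by move=> k _; rewrite exchange_big; apply: eq_bigr => i _; rewrite exchange_big.
    rewrite exchange_big; apply: eq_bigr => i _; rewrite exchange_big; exact: eq_bigr.
  move=> k _; rewrite raddf_sum /=; apply: eq_bigr => l _.
  rewrite comp_mpolyZ rmorphM /= -!/(lsubst g _) !lsubstX mulr_suml scaler_sumr.
  apply: eq_bigr => i _; rewrite mulr_sumr scaler_sumr; apply: eq_bigr => j _.
  by rewrite -scalerAl -scalerAr !scalerA [A k l * _]mulrC.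
apply: eq_bigr => i _; apply: eq_bigr => j _; rewrite !mxE scaler_suml exchange_big /=.
apply: eq_bigr => l _; rewrite !mxE -scaler_suml mulr_suml; congr (_ *: _).
by apply: eq_bigr => k _; rewrite mxE.
Qed.

(* GK need not be a group for an arbitrary polynomial Q. *)
Lemma GK_group_set Q P : Q = qform (coefmx Q) -> group_set (GK Q P).
Proof.
move=> defQ; apply/group_setP; split=> [|u v]; rewrite !inE.
  apply/asboolP; rewrite GL_1E; split; exists 1; rewrite ?oner_neq0 //.
    by rewrite trmx1 mul1mx mulmx1 scale1r.
  by exists 0; rewrite lsubst1 scale1r mul0r addr0.
move=> /asboolP[[m m0 mE] [r r0 [h hE]]] /asboolP[[n n0 nE] [s s0 [k kE]]].
apply/asboolP; rewrite GL_ME -mulmxE; split.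
  exists (m * n); first exact: mulf_neq0.
  rewrite trmx_mul -!mulmxA (mulmxA _ (coefmx Q)) (mulmxA _ (GLval u)) mE.
  by rewrite -scalemxAl -scalemxAr mulmxA nE scalerA.
exists (r * s); first exact: mulf_neq0.
have vQ : lsubst (GLval v) Q = n *: Q by rewrite {1}defQ lsubst_qform nE qformZ -defQ.
exists (r *: k + n *: lsubst (GLval v) h).
rewrite lsubst_comp hE /lsubst raddfD /= comp_mpolyZ rmorphM /= -!/(lsubst _ _).
by rewrite kE vQ scalerDr scalerA mulrDl -!scalerAl -scalerAr addrA.
Qed.

End Automorphisms.

Notation F11 := 'F_11.

Definition x : {mpoly F11[4]} := 'X_(@Ordinal 4 0 isT).
Definition y : {mpoly F11[4]} := 'X_(@Ordinal 4 1 isT).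
Definition z : {mpoly F11[4]} := 'X_(@Ordinal 4 2 isT).
Definition w : {mpoly F11[4]} := 'X_(@Ordinal 4 3 isT).

Definition QN1 : {mpoly F11[4]} := 2 * x * w + 2 * y * z.

Lemma mnm2_eq (a b c d : 'I_4) :
  (U_(a) + U_(b) == U_(c) + U_(d))%MM =
  all (fun k => (a == k :> nat) + (b == k :> nat) ==
                (c == k :> nat) + (d == k :> nat))%N (iota 0 4).
Proof.
apply/eqP/allP => [/mnmP E k|E].
  rewrite mem_iota /= => k4; have := E (Ordinal k4).
  by rewrite !mnmDE !mnm1E -!val_eqE /= => ->.
apply/mnmP => k; rewrite !mnmDE !mnm1E -!val_eqE /=; apply/eqP/E.
by rewrite mem_iota /=.
Qed.

Lemma coefmx_QN1 : coefmx QN1 = \matrix_(i, j) ((i + j == 3)%N)%:R.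
Proof.
apply/matrixP => i j; rewrite !mxE.
rewrite /QN1 /x /y /z /w -!mulrA !mulr_natl -!mpolyXD !mulr2n !mcoeffD !mcoeffX.
rewrite !mnm2_eq -val_eqE.
by case: i => [[|[|[|[|?]]]] ?] //; case: j => [[|[|[|[|?]]]] ?] //; apply/val_inj.
Qed.

Lemma QN1_qform : QN1 = qform (coefmx QN1).
Proof.
rewrite coefmx_QN1 /qform !big_ord_recl !big_ord0 !mxE /= !scale1r !scale0r.
rewrite !(add0r, addr0) /QN1 /x /y /z /w.
have <- : Ordinal (isT : 0 < 4)%N = ord0 by apply/val_inj.
have <- : Ordinal (isT : 1 < 4)%N = lift (Ordinal (isT : 0 < 4)%N) (@ord0 2).
  exact/val_inj.
have <- : Ordinal (isT : 2 < 4)%N = lift (Ordinal (isT : 0 < 4)%N) (lift ord0 (@ord0 1)).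
  exact/val_inj.
have <- : Ordinal (isT : 3 < 4)%N =
    lift (Ordinal (isT : 0 < 4)%N) (lift ord0 (lift ord0 (@ord0 0))).
  exact/val_inj.
by ring.
Qed.

Canonical GK_QN1_group (P : {mpoly F11[4]}) := Group (GK_group_set P QN1_qform).

Definition PN1_1 : {mpoly F11[4]} :=
  x^+2 * y + x^+2 * z + 2 * y^+2 * z + 5 * y^+2 * w + 9 * y * z^+2
  + y * z * w + 4 * z^+3 + 3 * z^+2 * w + 10 * z * w^+2 + w^+3.

Definition PN1_2 : {mpoly F11[4]} :=
  x^+2 * y + x^+2 * z + y^+3 + y^+2 * z + 7 * y * z^+2 + 4 * y * w^+2
  + 2 * z^+3 + 9 * z * w^+2.

Definition PN1_3 : {mpoly F11[4]} :=
  x^+2 * y + x^+2 * z + y^+3 + 8 * y^+2 * z + 3 * y * z^+2 + 10 * y * w^+2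
  + 10 * z^+3 + 10 * z * w^+2.

Definition PN1_4 : {mpoly F11[4]} :=
  x^+2 * y + x^+2 * z + y^+3 + 9 * y^+2 * z + 2 * y^+2 * w + 3 * y * z^+2
  + 3 * y * z * w + 4 * y * w^+2 + 10 * z^+3 + 2 * z^+2 * w + 6 * z * w^+2.

Definition PN1_5 : {mpoly F11[4]} :=
  x^+2 * y + x^+2 * z + x * z^+2 + 10 * y^+2 * w + 9 * y * z^+2
  + 9 * y * w^+2 + 8 * z^+3 + 8 * z^+2 * w + 8 * z * w^+2 + 3 * w^+3.

Definition PN1_6 : {mpoly F11[4]} :=
  x^+2 * y + x^+2 * z + x * z^+2 + 9 * y^+2 * z + 5 * y^+2 * w + y * z * w
  + 8 * y * w^+2 + 3 * z^+3 + 9 * z^+2 * w + 2 * z * w^+2 + 5 * w^+3.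

Definition PN1_7 : {mpoly F11[4]} :=
  x^+2 * y + x^+2 * z + x * z^+2 + 4 * y^+3 + 2 * y^+2 * z + 10 * y^+2 * w
  + 3 * y * z^+2 + 8 * y * z * w + 8 * y * w^+2 + 8 * z^+3 + 7 * z^+2 * w
  + 7 * z * w^+2 + 4 * w^+3.

Definition PN1_8 : {mpoly F11[4]} :=
  x^+2 * y + x^+2 * z + x * z^+2 + 9 * y^+3 + 6 * y^+2 * z + 5 * y^+2 * w
  + 8 * y * z^+2 + 5 * y * z * w + 2 * y * w^+2 + z^+3 + 2 * z^+2 * w
  + 7 * z * w^+2 + w^+3.

(* Main.v *)
(* An element g of GK satisfies P(g v) = r P(v) at the points v of the quadric.
   Cubing is a bijection of F_11^*, so every class modulo scalars contains a g
   with r = 1.  The columns of such a g are isotropic vectors with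
   P(g e_k) = P(e_k), with prescribed orthogonality relations, and the values
   of P along the lines e_0 e_1 and e_0 e_2 of the quadric are preserved.  This
   leaves so few possibilities that a column by column search over F_11^4 lists
   all automorphisms; each is found to be proportional to a word in the given
   generators.  That the generators preserve P modulo Q is tested on the
   polarizations of the cubic forms, which determine them since 6 is
   invertible. *)

Require Import Defs.
From HB Require Import structures.
From Stdlib Require Import ZArith.
From mathcomp Require Import all_boot all_order all_algebra all_fingroup.
From mathcomp Require Import boolp ring zify ssrZ cyclic.
From mathcomp Require Import mpoly.

Set Implicit Arguments.
Unset Strict Implicit.
Unset Printing Implicit Defensive.

Import GRing.Theory.
Local Open Scope ring_scope.
Delimit Scope Z_scope with BZ.

(** * Residues and cubic forms *)

(** All computations run on binary integers, which [vm_compute] handles fast; they reach F_11 only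
    through this ring morphism, and reduction modulo 11 takes place only in comparisons. *)
Definition zF : Z -> F11 := intr \o int_of_Z.
HB.instance Definition _ := GRing.RMorphism.copy zF (intr \o int_of_Z).

Definition eq11 (a b : Z) : bool := Z.eqb (Z.modulo (Z.sub a b) 11) 0.

(** Euclidean division gives a - b = 11 q + r, and [zF 11 = 0], so the images agree exactly when
    [zF r = 0]; as 0 <= r < 11, this means r = 0. *)
Lemma eq11P a b : reflect (zF a = zF b) (eq11 a b).
Proof.
have z11 : zF 11 = 0 by apply/val_inj.
have E : (zF a == zF b) = (zF (Z.modulo (Z.sub a b) 11) == 0).
  rewrite -[zF (Z.modulo _ _)]add0r -{1}(mul0r (zF (Z.div (Z.sub a b) 11))) -z11.
  rewrite -rmorphM -rmorphD (_ : _ + _ = a - b); last exact/esym/Z.div_mod.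
  by rewrite rmorphB z11 subr_eq0.
suff -> : eq11 a b = (zF a == zF b) by exact: eqP.
rewrite E /eq11; have := Z.mod_pos_bound (Z.sub a b) 11 (erefl _).
move: (Z.modulo _ _) => m [/Z2Nat.id <-]; move: (Z.to_nat m) => n n11.
rewrite (_ : zF (Z.of_nat n) = n%:R); last first.
  by rewrite /zF /= -[Z.of_nat n]/(Z_of_int n) Z_of_intK.
by rewrite -val_eqE /= val_Fp_nat // modn_small; lia.
Qed.

Definition residues : seq Z := [:: 0; 1; 2; 3; 4; 5; 6; 7; 8; 9; 10]%BZ.

Definition rep (a : F11) : Z := Z.of_nat a.

Lemma rep_residue a : rep a \in residues.
Proof. by case: a => n n11; do 11?[case: n n11 => [|n] n11 //]. Qed.

Lemma repK : cancel rep zF.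
Proof. by case=> n n11; apply/val_inj; do 11?[case: n n11 => [|n] n11 //]. Qed.

(** * Cubic forms over an arbitrary ring and their polarization *)

Section Cubic.

Variable R : comNzRingType.
Implicit Types (s : seq (R * (nat * nat * nat))) (u v : nat -> R).

(** The ring is left arbitrary because one list of monomials is evaluated over the integers (to
    compute), over F_11 (at points) and over the polynomial ring (as the form itself). *)
Definition cubic s v : R :=
  foldr (fun t acc => let: (c, (i, j, k)) := t in c * v i * v j * v k + acc) 0 s.

(** The full polarization: each monomial is summed over the six permutations of its arguments,
    without dividing by 6. *)
Definition polar s u v u' : R :=
  foldr (fun t acc => let: (c, (i, j, k)) := t in
     c * (u i * (v j * u' k + u' j * v k) + v i * (u j * u' k + u' j * u k)
          + u' i * (u j * v k + v j * u k)) + acc) 0 s.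

Lemma polar_diag s v : polar s v v v = 6 * cubic s v.
Proof.
elim: s => [|[c [[i j] k]] s IHs] /=; first by rewrite mulr0.
by rewrite IHs; ring.
Qed.

Lemma polarC12 s u v u' : polar s u v u' = polar s v u u'.
Proof. by elim: s => [|[c [[i j] k]] s /= ->] //; ring. Qed.

Lemma polarC23 s u v u' : polar s u v u' = polar s u u' v.
Proof. by elim: s => [|[c [[i j] k]] s /= ->] //; ring. Qed.

Lemma polar_sum s n (t : 'I_n -> R) (U : 'I_n -> nat -> R) v u' :
  polar s (fun i => \sum_a t a * U a i) v u' = \sum_a t a * polar s (U a) v u'.
Proof.
elim: s => [|[c [[i j] k]] s /= ->].
  by rewrite /= big1 // => a _; rewrite mulr0.
rewrite !mulr_suml !mulr_sumr -!big_split !mulr_sumr -!big_split mulr_sumr.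
rewrite -big_split /=.
by apply: eq_bigr => a _; ring.
Qed.

(** Trilinear expansion on the diagonal. Linearity is known in the first argument only, so the
    symmetries move each argument there in turn. *)
Lemma cubic_sum s n (t : 'I_n -> R) (U : 'I_n -> nat -> R) :
  6 * cubic s (fun i => \sum_a t a * U a i) =
  \sum_a \sum_b \sum_c t a * t b * t c * polar s (U a) (U b) (U c).
Proof.
rewrite -polar_diag polar_sum; apply: eq_bigr => a _.
rewrite polarC12 polar_sum mulr_sumr; apply: eq_bigr => b _.
rewrite polarC12 polarC23 polarC12 polar_sum !mulr_sumr; apply: eq_bigr => c _.
by rewrite polarC12 polarC23 !mulrA.
Qed.

Lemma eq_cubic s u v : u =1 v -> cubic s u = cubic s v.
Proof. by move=> uv; elim: s => //= -[c [[i j] k]] s ->; rewrite !uv. Qed.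

Lemma cubicZ s a v : cubic s (fun i => a * v i) = a ^+ 3 * cubic s v.
Proof.
elim: s => [|[c [[i j] k]] s IHs] /=; first by rewrite mulr0.
by rewrite IHs; ring.
Qed.

Lemma cubic_cat s s' v : cubic (s ++ s') v = cubic s v + cubic s' v.
Proof. by elim: s => [|[c [[i j] k]] s /= ->]; rewrite ?add0r ?addrA. Qed.

End Cubic.

Definition mapc (R S : Type) (f : R -> S) (s : seq (R * (nat * nat * nat))) :=
  [seq (f t.1, t.2) | t <- s].

Lemma rmorph_cubic (R S : comNzRingType) (f : {rmorphism R -> S}) s v :
  f (cubic s v) = cubic (mapc f s) (f \o v).
Proof.
by elim: s => [|[c [[i j] k]] s IHs] /=; rewrite ?rmorph0 ?rmorphD ?IHs ?rmorphM.
Qed.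

Lemma rmorph_polar (R S : comNzRingType) (f : {rmorphism R -> S}) s u v u' :
  f (polar s u v u') = polar (mapc f s) (f \o u) (f \o v) (f \o u').
Proof.
elim: s => [|[c [[i j] k]] s IHs] /=; first by rewrite rmorph0.
by rewrite rmorphD IHs !(rmorphM, rmorphD) /=.
Qed.

Definition cform := seq (Z * (nat * nat * nat)).

Definition mon (c : Z) (i j k : nat) : Z * (nat * nat * nat) := (c, (i, j, k)).

(** * The search *)

(* A matrix is encoded as the list of its columns. *)
Definition lin (A : seq (seq Z)) (v : seq Z) : seq Z :=
  [seq foldr (fun j acc => nth 0 v j * nth 0 (nth [::] A j) i + acc)%BZ Z0 (iota 0 4)
  | i <- iota 0 4].

Definition mulcols (A B : seq (seq Z)) : seq (seq Z) :=
  [seq lin A (nth [::] B j) | j <- iota 0 4].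

Definition idcols : seq (seq Z) :=
  [:: [:: 1; 0; 0; 0]; [:: 0; 1; 0; 0]; [:: 0; 0; 1; 0]; [:: 0; 0; 0; 1]]%BZ.

(** The symmetric bilinear form of [QN1]; [dotq v v] is the value of [QN1] at [v]. *)
Definition dotq (u v : seq Z) : Z :=
  (nth 0 u 0 * nth 0 v 3 + nth 0 u 1 * nth 0 v 2 + nth 0 u 2 * nth 0 v 1
   + nth 0 u 3 * nth 0 v 0)%BZ.

Definition eval (s : cform) (v : seq Z) : Z :=
  foldr (fun t acc => let: (c, (i, j, k)) := t in
    c * nth 0 v i * nth 0 v j * nth 0 v k + acc)%BZ Z0 s.

Definition vecs : seq (seq Z) :=
  [seq a :: v | a <- residues, v <-
  [seq a :: v | a <- residues, v <-
  [seq a :: v | a <- residues, v <- [seq [:: a] | a <- residues]]]].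

Definition isos : seq (seq Z) := [seq v <- vecs | eq11 (dotq v v) 0].

Definition level (s : cform) (k : nat) : seq (seq Z) :=
  [seq v <- isos | eq11 (eval s v) (eval s (nth [::] idcols k))].

Definition agree (s : cform) (A pts : seq (seq Z)) : bool :=
  all (fun v => eq11 (eval s (lin A v)) (eval s v)) pts.

(* Points of the quadric.  On (1, b, c, - b c) the form P has degree at most 3
   in b and in c, so a grid of 4 x 4 points determines it. *)
Definition pts1 : seq (seq Z) := [:: [:: 1; 1]; [:: 1; 2]]%BZ.
Definition pts2 : seq (seq Z) := [:: [:: 1; 0; 1]; [:: 1; 0; 2]]%BZ.
Definition pts3 : seq (seq Z) :=
  [seq [:: 1; b; c; - (b * c)]%BZ | b <- take 4 residues, c <- take 4 residues].

Definition propcols (A B : seq (seq Z)) : bool :=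
  has (fun a : Z =>
    all (fun j =>
      all (fun i => eq11 (a * (nth [::] A j)`_i) (nth [::] B j)`_i) (iota 0 4))
      (iota 0 4)) residues.

(* The tests are nested conditionals because vm_compute evaluates both sides
   of && . *)
Definition search (s : cform) (accept : seq (seq Z) -> bool) : bool :=
  let C1 := level s 1 in let C2 := level s 2 in let C3 := level s 3 in
  let step1 c0 c1 :=
    if eq11 (dotq c0 c1) 0 then agree s [:: c0; c1] pts1 else false in
  let step2 c0 c2 :=
    if eq11 (dotq c0 c2) 0 then agree s [:: c0; [::]; c2] pts2 else false in
  let step3 c0 c1 c2 c3 :=
    if eq11 (dotq c0 c3) (dotq c1 c2) then
      if eq11 (dotq c0 c3) 0 then false else
      if eq11 (dotq c1 c3) 0 then
        if eq11 (dotq c2 c3) 0 then agree s [:: c0; c1; c2; c3] pts3 else false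
      else false
    else false in
  all (fun c0 =>
    all (fun c1 =>
      all (fun c2 =>
        all (fun c3 => accept [:: c0; c1; c2; c3])
          [seq c3 <- C3 | step3 c0 c1 c2 c3])
        [seq c2 <- C2 | step2 c0 c2])
      [seq c1 <- C1 | step1 c0 c1])
    (level s 0).

(** An index beyond [gs] stands for the identity matrix, in agreement with the default [1] used for
    words in the group. *)
Definition wordcols (gs : seq (seq (seq Z))) (w : seq nat) : seq (seq Z) :=
  foldr (fun i B => mulcols (nth idcols gs i) B) idcols w.

Definition complete (s : cform) gs ws : bool :=
  let Bs := [seq wordcols gs w | w <- ws] in
  search s (fun A => has (propcols A) Bs).

(** * From integer lists to matrices over F_11 *)

Local Arguments Z.mul : simpl never.
Local Arguments Z.add : simpl never.

Definition mxcols (A : seq (seq Z)) : 'M[F11]_4 :=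
  \matrix_(i, j) zF (nth Z0 (nth [::] A j) i).

Lemma zF_add a b : zF (Z.add a b) = zF a + zF b.
Proof. exact: (rmorphD zF). Qed.

Lemma zF_mul a b : zF (Z.mul a b) = zF a * zF b.
Proof. exact: (rmorphM zF). Qed.

Lemma zF_eval s v :
  zF (eval s v) = cubic (mapc zF s) (fun i => zF (nth Z0 v i)).
Proof. exact: (rmorph_cubic zF s (nth Z0 v)). Qed.

Lemma zF_dotq u v : zF (dotq u v) =
  \sum_(i < 4) \sum_(j < 4) zF (nth Z0 u i) * ((i + j == 3)%N)%:R
    * zF (nth Z0 v j).
Proof.
rewrite !big_ord_recl !big_ord0 /= !(mulr1, mulr0, mul0r, addr0, add0r).
by rewrite /dotq !zF_add !zF_mul !addrA.
Qed.

Lemma zF_lin A v (i : 'I_4) :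
  zF (nth Z0 (lin A v) i) = \sum_j mxcols A i j * zF (nth Z0 v j).
Proof.
rewrite !big_ord_recl big_ord0 !mxE (nth_map 0%N) ?size_iota // nth_iota //=.
by rewrite !zF_add !zF_mul !(mulrC (zF (nth Z0 v _))).
Qed.

Lemma mxcols_mul A B : mxcols (mulcols A B) = mxcols A *m mxcols B.
Proof.
apply/matrixP => i j; rewrite !mxE (nth_map 0%N) ?size_iota //.
by rewrite nth_iota // zF_lin; apply: eq_bigr => k _; rewrite !mxE.
Qed.

Lemma mxcols_one : mxcols idcols = 1%:M.
Proof.
apply/matrixP => i j; rewrite !mxE.
by case: i => [[|[|[|[|i]]]] i4]; case: j => [[|[|[|[|j]]]] j4] //; apply/val_inj.
Qed.

Lemma in_iota4 k : (k \in iota 0 4) = (k < 4)%N.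
Proof. by rewrite mem_iota. Qed.

Lemma propcolsP A B :
  reflect (exists a, mxcols B = a *: mxcols A) (propcols A B).
Proof.
apply: (iffP hasP) => [[a _ aAB]|[a aAB]].
  exists (zF a); apply/matrixP => i j; rewrite !mxE -zF_mul; apply/esym/eq11P.
  have /(allP aAB)/allP/(_ i) : (j : nat) \in iota 0 4 by rewrite in_iota4.
  by apply; rewrite in_iota4.
exists (rep a); first exact: rep_residue.
apply/allP => j; rewrite in_iota4 => j4; apply/allP => i; rewrite in_iota4 => i4.
apply/eq11P; rewrite zF_mul repK.
by have /matrixP/(_ (Ordinal i4))/(_ (Ordinal j4)) := aAB; rewrite !mxE.
Qed.

(** The entry (i, j) of the Gram matrix is the product of columns i and j for the bilinear form, and
    [coefmx QN1] is the antidiagonal permutation matrix. *)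
Lemma dotq_gram A mu :
  (mxcols A)^T *m coefmx QN1 *m mxcols A = mu *: coefmx QN1 <->
  forall i j : 'I_4,
    zF (dotq (nth [::] A i) (nth [::] A j)) = mu * ((i + j == 3)%N)%:R.
Proof.
suff E i j : ((mxcols A)^T *m coefmx QN1 *m mxcols A) i j
    = zF (dotq (nth [::] A i) (nth [::] A j)).
  split=> [/matrixP H i j|H]; last apply/matrixP => i j.
    by rewrite -E H coefmx_QN1 !mxE.
  by rewrite E H coefmx_QN1 !mxE.
rewrite zF_dotq mxE exchange_big; apply: eq_bigr => k _ /=.
rewrite mxE mulr_suml; apply: eq_bigr => l _.
by rewrite coefmx_QN1 !mxE.
Qed.

(** * Cubic forms as polynomials, and soundness of the search *)

Definition cubic_mpoly (s : cform) : {mpoly F11[4]} :=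
  cubic (mapc (@mpolyC 4 F11 \o zF) s) (nth 0 [:: x; y; z; w]).

Lemma nth_xyzw (i : 'I_4) : nth 0 [:: x; y; z; w] i = 'X_i.
Proof.
by case: i => [[|[|[|[|i]]]] i4] //=; congr 'X_[U_(_)]; apply/val_inj.
Qed.

Lemma meval_cubic_mpolyE s (v : 'I_4 -> F11) :
  (cubic_mpoly s).@[v] = cubic (mapc zF s) (meval v \o nth 0 [:: x; y; z; w]).
Proof.
rewrite rmorph_cubic /mapc -map_comp.
by rewrite (eq_map (g := fun t => (zF t.1, t.2))) // => t /=; rewrite mevalC.
Qed.

(** The bound on the length concerns indices i >= 4 in [s]: the polynomial side has the default 0
    there, and so must [v]. *)
Lemma meval_cubic_mpoly s v : (size v <= 4)%N ->
  (cubic_mpoly s).@[fun j => zF (nth Z0 v j)] = zF (eval s v).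
Proof.
move=> v4; rewrite meval_cubic_mpolyE zF_eval.
apply: eq_cubic => i /=; case: (ltnP i 4) => i4.
  by rewrite (nth_xyzw (Ordinal i4)) mevalXU.
by rewrite !nth_default ?(leq_trans v4) // !rmorph0.
Qed.

Lemma meval_QN1 v :
  QN1.@[fun j => zF (nth Z0 v j)] = zF (dotq v v).
Proof.
by rewrite /QN1 !rmorphD !rmorphM /= !rmorph_nat !mevalXU /=; ring.
Qed.

(** What the search uses of an element of [GK] normalized to r = 1. The congruence modulo [QN1] is
    weakened to equality of values at isotropic vectors over F_11; a necessary condition is enough
    to bound the group from above. *)
Record autom (s : cform) (A : seq (seq Z)) : Prop := Autom {
  autom_gram : exists2 mu : F11, mu != 0 &
    forall i j, (i < 4)%N -> (j < 4)%N ->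
      zF (dotq (nth [::] A i) (nth [::] A j)) = mu * ((i + j == 3)%N)%:R;
  autom_eval : forall v, (size v <= 4)%N -> eq11 (dotq v v) 0 ->
    eq11 (eval s (lin A v)) (eval s v) }.

Lemma vecsP v : v \in vecs <->
  exists a b c d, v = [:: a; b; c; d] /\ all (mem residues) v.
Proof.
split=> [/allpairsPdep[a [v1 [aR v1E ->]]]|].
  have /allpairsPdep[b [v2 [bR v2E ->]]] := v1E.
  have /allpairsPdep[c [v3 [cR /mapP[d dR ->] ->]]] := v2E.
  by exists a, b, c, d; split=> //=; rewrite aR bR cR dR.
move=> [a [b [c [d [-> /and5P[aR bR cR dR _]]]]]].
by do 3!apply: allpairs_f => //; apply: map_f.
Qed.

Lemma eq_eval s u v : nth Z0 u =1 nth Z0 v -> eval s u = eval s v.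
Proof. exact: eq_cubic. Qed.

(** Column k is the image of the basis vector e_k, which is isotropic since k + k is never 3; hence
    the column is isotropic and P takes the same value on it as on e_k. *)
Lemma autom_level s A k : (k < 4)%N -> autom s A -> nth [::] A k \in vecs ->
  nth [::] A k \in level s k.
Proof.
move=> k4 [[mu mu0 gram] ev] Ak; rewrite !mem_filter Ak andbT.
apply/andP; split; last first.
  apply/eq11P; rewrite gram // addnn rmorph0.
  by case: k k4 {Ak} => [|[|[|[|]]]] //= _; rewrite mulr0.
have -> : eval s (nth [::] A k) = eval s (lin A (nth [::] idcols k)).
  apply: eq_eval; have /vecsP[a [b [c [d [E _]]]]] := Ak.
  case: k k4 {Ak} E => [|[|[|[|]]]] //= _ E [|[|[|[|i]]]] /=; rewrite ?E /=; lia.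
by apply: ev; case: k k4 {Ak} => [|[|[|[|]]]].
Qed.

Lemma searchP s accept c0 c1 c2 c3 :
  search s accept -> all (mem vecs) [:: c0; c1; c2; c3] ->
  autom s [:: c0; c1; c2; c3] -> accept [:: c0; c1; c2; c3].
Proof.
move=> srch /and5P[v0 v1 v2 v3 _] aut.
have [[mu mu0 gram] ev] := aut.
have agr pts : all (fun v => (size v <= 4)%N && eq11 (dotq v v) 0) pts ->
    agree s [:: c0; c1; c2; c3] pts.
  by move=> /allP ok; apply/allP => v /ok /andP[]; apply: ev.
have orth i j : (i < 4)%N -> (j < 4)%N -> (i + j != 3)%N ->
    eq11 (dotq (nth [::] [:: c0; c1; c2; c3] i) (nth [::] [:: c0; c1; c2; c3] j)) 0.
  by move=> i4 j4 /negPf ij; apply/eq11P; rewrite gram // ij mulr0 rmorph0.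
have := allP srch c0 (autom_level (k := 0) isT aut v0).
move/allP/(_ c1).
rewrite mem_filter (autom_level (k := 1) isT aut v1) (orth 0%N 1%N) //.
(* The missing coordinates of these points are read as 0 and a product with first factor 0 reduces
   to 0, so the columns not yet chosen disappear by conversion. *)
have -> : agree s [:: c0; c1] pts1 := agr pts1 isT.
move=> /(_ isT) /allP/(_ c2).
rewrite mem_filter (autom_level (k := 2) isT aut v2) (orth 0%N 2%N) //.
have -> : agree s [:: c0; [::]; c2] pts2 := agr pts2 isT.
move=> /(_ isT) /allP/(_ c3).
rewrite mem_filter (autom_level (k := 3) isT aut v3).
rewrite (orth 1%N 3%N) // (orth 2%N 3%N) // (agr pts3) //.
have -> : eq11 (dotq c0 c3) (dotq c1 c2).
  by apply/eq11P; rewrite (gram 0%N 3%N) // (gram 1%N 2%N).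
(* The product of the outer columns is mu itself, hence nonzero. *)
suff /negPf -> : ~~ eq11 (dotq c0 c3) 0 by apply.
by apply/eq11P; rewrite (gram 0%N 3%N) //= mulr1 rmorph0; apply/eqP.
Qed.

Definition colsof (g : 'M[F11]_4) : seq (seq Z) :=
  [seq [seq rep (g (inord i) (inord j)) | i <- iota 0 4] | j <- iota 0 4].

Lemma colsofK : cancel colsof mxcols.
Proof.
move=> g; apply/matrixP => i j; rewrite !mxE.
by rewrite !(nth_map 0%N) ?size_iota // !nth_iota // repK !inord_val.
Qed.

Lemma colsof_vecs g : all (mem vecs) (colsof g).
Proof.
apply/allP => v /mapP[j _ ->]; apply/vecsP; do 4!eexists; split; first by [].
by rewrite /= !rep_residue.
Qed.

Lemma autom_colsof s (g : 'M[F11]_4) (mu : F11) :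
  mu != 0 -> g^T *m coefmx QN1 *m g = mu *: coefmx QN1 ->
  (forall v, QN1.@[v] = 0 ->
     (cubic_mpoly s).@[fun i => \sum_j g i j * v j] = (cubic_mpoly s).@[v]) ->
  autom s (colsof g).
Proof.
move=> mu0 gram ev; split.
  exists mu => // i j i4 j4; move: gram; rewrite -{1 2}(colsofK g).
  by move/dotq_gram/(_ (Ordinal i4) (Ordinal j4)).
move=> v v4 /eq11P Qv; apply/eq11P; rewrite -!meval_cubic_mpoly //.
rewrite -[RHS]ev ?meval_QN1 ?Qv ?rmorph0 //; apply: meval_eq => i.
by rewrite zF_lin colsofK.
Qed.

Lemma meval_lsubst g (P : {mpoly F11[4]}) v :
  (lsubst g P).@[v] = P.@[fun i => \sum_j g i j * v j].
Proof.
rewrite comp_mpoly_meval; apply: meval_eq => i; rewrite tnth_mktuple.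
by rewrite raddf_sum; apply: eq_bigr => j _; rewrite /= mevalZ mevalXU.
Qed.

Lemma meval_scale s a (v : 'I_4 -> F11) :
  (cubic_mpoly s).@[fun i => a * v i] = a ^+ 3 * (cubic_mpoly s).@[v].
Proof.
rewrite !meval_cubic_mpolyE -cubicZ; apply: eq_cubic => i /=.
case: (ltnP i 4) => i4.
  by rewrite (nth_xyzw (Ordinal i4)) !mevalXU.
by rewrite !nth_default // !rmorph0 mulr0.
Qed.

(** Fermat: r^10 = 1. In this form it says that the factor r^3, once cubed, is the inverse of r. *)
Lemma F11_cube (r : F11) : r != 0 -> (r ^+ 3) ^+ 3 * r = 1.
Proof.
have : all (fun a => eq11 a 0 || eq11 (a ^+ 3 ^+ 3 * a) 1) residues by [].
move=> /allP/(_ _ (rep_residue r))/orP[]/eq11P.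
  by rewrite repK rmorph0 => ->; rewrite eqxx.
by rewrite !(rmorphM, rmorphXn) /= repK.
Qed.

Lemma GK_autom s (u : {'GL_4[F11]}) : u \in GK QN1 (cubic_mpoly s) ->
  exists a, autom s (colsof (a *: GLval u)).
Proof.
rewrite inE => /asboolP[[mu mu0 gram] [r r0 [h hE]]].
set g := GLval u in gram hE *; have c1 := F11_cube r0.
have c0 : r ^+ 3 != 0 by rewrite expf_neq0.
(* Scaling g by r^3 multiplies P(g v) by r^9, which cancels r; the multiplier of the quadratic form
   becomes r^6 mu. *)
exists (r ^+ 3).
apply: (@autom_colsof _ _ (r ^+ 3 * r ^+ 3 * mu)); first by rewrite !mulf_neq0.
  have -> : (r ^+ 3 *: g)^T = r ^+ 3 *: g^T by rewrite linearZ.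
  by rewrite -scalemxAr -!scalemxAl gram !scalerA.
(* Evaluation at a point of the quadric removes the term [h * QN1]. *)
move=> v Qv; have := congr1 (meval v) hE.
rewrite meval_lsubst rmorphD rmorphM /= mevalZ Qv mulr0 addr0 => E.
rewrite -[RHS]mul1r -c1 -mulrA -E -meval_scale; apply: meval_eq => i.
by rewrite mulr_sumr; apply: eq_bigr => j _; rewrite mxE mulrA.
Qed.

(** * Invariance of the generators *)

(* The product of QN1 with the linear form whose coefficients are listed in h. *)
Definition times_QN1 (h : seq Z) : cform :=
  flatten [seq [:: mon (2 * nth 0 h a) a 0 3; mon (2 * nth 0 h a) a 1 2]
          | a <- iota 0 4].

Lemma cubic_mpoly_times_QN1 s h :
  exists l, cubic_mpoly (s ++ times_QN1 h) = cubic_mpoly s + l * QN1.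
Proof.
exists (\sum_(a < 4) (zF (nth Z0 h a))%:MP_[4] * nth 0 [:: x; y; z; w] a).
rewrite /cubic_mpoly /mapc map_cat cubic_cat; congr (_ + _).
rewrite !big_ord_recl big_ord0 /= !zF_mul !mpolyCM.
have -> : (zF 2)%:MP_[4] = 2 by rewrite -[RHS]mpolyC_nat; congr (_%:MP); apply/val_inj.
rewrite /QN1; ring.
Qed.

(** The generators are given with mu = 1 and r = 1, and [h] is a certificate: the linear form l such
    that g . P = P + l Q. Both cubic forms are compared through their polarizations at the basis
    vectors. *)
Definition invariant_cols (s : cform) (A : seq (seq Z)) (h : seq Z) : bool :=
  let e i := nth Z0 (nth [::] idcols i) in
  let c i := nth Z0 (nth [::] A i) in
  [&& all (fun v : seq Z => size v <= 4)%N A,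
      all (fun i => all (fun j =>
          eq11 (dotq (nth [::] A i) (nth [::] A j))
               (if (i + j == 3)%N then 1 else 0)%BZ)
        (iota 0 4)) (iota 0 4)
    & all (fun i => all (fun j => all (fun k =>
          eq11 (polar s (c i) (c j) (c k))
               (polar (s ++ times_QN1 h) (e i) (e j) (e k)))
        (iota 0 4)) (iota 0 4)) (iota 0 4)].

(** The form g . P is P evaluated at the generic combination of the columns, with the variables as
    coefficients; [cubic_sum] over the polynomial ring expands it. *)
Lemma lsubst_polar s A : all (fun c : seq Z => size c <= 4)%N A ->
  6 * lsubst (mxcols A) (cubic_mpoly s) =
  \sum_(a < 4) \sum_(b < 4) \sum_(c < 4) 'X_a * 'X_b * 'X_c *
    (zF (polar s (nth Z0 (nth [::] A a)) (nth Z0 (nth [::] A b))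
                 (nth Z0 (nth [::] A c))))%:MP.
Proof.
move=> A4; pose U (a : 'I_4) i := (zF (nth Z0 (nth [::] A a) i))%:MP_[4].
have -> : lsubst (mxcols A) (cubic_mpoly s) =
    cubic (mapc (@mpolyC 4 F11 \o zF) s) (fun i => \sum_a 'X_a * U a i).
  rewrite /lsubst rmorph_cubic /mapc -map_comp.
  rewrite (eq_map (g := fun t => ((@mpolyC 4 F11 \o zF) t.1, t.2))); last first.
    by move=> t /=; rewrite comp_mpolyC.
  apply: eq_cubic => i /=; rewrite -/(lsubst _ _); case: (ltnP i 4) => i4.
    rewrite (nth_xyzw (Ordinal i4)) lsubstX; apply: eq_bigr => j _.
    by rewrite mxE mulrC mul_mpolyC.
  (* Beyond the fourth coordinate both sides are 0, because no column has more than four entries. *)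
  rewrite nth_default // /lsubst raddf0 big1 // => a _.
  rewrite /U nth_default ?rmorph0 ?mulr0 // (leq_trans _ i4) //.
  case: (ltnP a (size A)) => aA; last by rewrite (nth_default _ aA).
  exact: (all_nthP [::] A4).
rewrite cubic_sum; apply: eq_bigr => a _; apply: eq_bigr => b _; apply: eq_bigr => c _.
by rewrite !(rmorph_polar zF, rmorph_polar (@mpolyC 4 F11)) /mapc -map_comp.
Qed.

(** Modulo 11 the inverse of 6 is 2. *)
Lemma mpoly_6_inj : injective (fun p : {mpoly F11[4]} => 6 * p).
Proof.
have E : 2 * 6 = 1 :> {mpoly F11[4]}.
  rewrite -natrM -[LHS]mpolyC_nat -mpolyC1; congr (_%:MP); exact/val_inj.
by move=> p q /(congr1 (fun r => 2 * r)); rewrite !mulrA E !mul1r.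
Qed.

Lemma coefmx_QN1_sqr : coefmx QN1 *m coefmx QN1 = 1%:M.
Proof.
apply/matrixP => i j; rewrite coefmx_QN1 !mxE !big_ord_recl big_ord0 !mxE.
by case: i => [[|[|[|[|i]]]] i4]; case: j => [[|[|[|[|j]]]] j4] //; apply/val_inj.
Qed.

Lemma invariant_cols_GK s A h : invariant_cols s A h ->
  exists2 u : {'GL_4[F11]}, u \in GK QN1 (cubic_mpoly s) & GLval u = mxcols A.
Proof.
move=> /and3P[A4 gram polA].
have gramA : (mxcols A)^T *m coefmx QN1 *m mxcols A = 1 *: coefmx QN1.
  apply/dotq_gram => i j; rewrite mul1r.
  have /allP/(_ j) := allP gram i (etrans (in_iota4 i) (ltn_ord i)).
  rewrite in_iota4 => /(_ (ltn_ord j))/eq11P ->.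
  by case: ifP => _; rewrite ?rmorph0 ?rmorph1.
(* From A^T phi A = phi and phi^2 = 1, the matrix phi A^T phi is an inverse of A. *)
have [|_ uA] := @mulmx1_unit _ _ (coefmx QN1 *m (mxcols A)^T *m coefmx QN1)
    (mxcols A).
  by rewrite -!mulmxA (mulmxA (mxcols A)^T) gramA scale1r coefmx_QN1_sqr.
exists (FinRing.Unit uA) => //; rewrite inE; apply/asboolP; split.
  by exists 1; rewrite ?oner_neq0.
have [l lE] := cubic_mpoly_times_QN1 s h.
exists 1; rewrite ?oner_neq0 //; exists l; rewrite scale1r -lE.
(* The right-hand side is written as its own substitution by the identity, so that both sides,
   multiplied by 6, expand by [lsubst_polar] and are compared term by term. *)
rewrite -[RHS]lsubst1 -mxcols_one; apply: mpoly_6_inj.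
apply: etrans (lsubst_polar s A4) _; apply: etrans (esym (lsubst_polar _ _)) => //.
apply: eq_bigr => a _; apply: eq_bigr => b _; apply: eq_bigr => c _.
congr (_ * _%:MP); apply/eq11P.
have /allP/(_ b) := allP polA a (etrans (in_iota4 a) (ltn_ord a)).
rewrite in_iota4 => /(_ (ltn_ord b))/allP/(_ c).
by rewrite in_iota4 => /(_ (ltn_ord c)).
Qed.

(** * Words and quotients *)

Section Words.

Variables (gT : finGroupType) (H G : {group gT}) (us : seq gT) (ws : seq (seq nat)).
Hypothesis normH : forall u, u \in 'N(H)%g.
Hypothesis us_G : {in us, forall u, u \in G}.

Definition word (w : seq nat) : gT := (\prod_(i <- w) nth 1 us i)%g.

Lemma coset_eqP u v : coset H u = coset H v <-> (v * u^-1)%g \in H.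
Proof.
have kerP := rcoset_kercosetP (normH v) (normH u).
by rewrite -mem_rcoset; split=> [/esym/kerP|/kerP/esym].
Qed.

Lemma coset_nth_gen i :
  coset H (nth 1%g us i) \in <<[set a in [seq coset H u | u <- us]]>>%g.
Proof.
case: (ltnP i (size us)) => ius; last by rewrite nth_default // coset_id ?group1.
by rewrite mem_gen // inE map_f // mem_nth.
Qed.

Lemma word_mem w : word w \in G.
Proof.
rewrite /word; apply: group_prod => i _.
by case: (ltnP i (size us)) => ius; [rewrite us_G ?mem_nth | rewrite nth_default].
Qed.

Lemma coset_word_gen w :
  coset H (word w) \in <<[set a in [seq coset H u | u <- us]]>>%g.
Proof.
elim: w => [|i w IHw]; first by rewrite /word big_nil coset_id ?group1.
by rewrite /word big_cons morphM ?normH //= groupM // coset_nth_gen.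
Qed.

(** This is what the exhaustive search supplies. *)
Hypothesis ws_total : forall u, u \in G ->
  exists2 w, w \in ws & coset H u = coset H (word w).

Lemma quotient_words : (G / H)%g =i [seq coset H (word w) | w <- ws].
Proof.
move=> a; apply/idP/mapP => [/morphimP[u _ /ws_total[w ws_w uw] ->]|[w _ ->]].
  by exists w.
by rewrite mem_quotient ?word_mem.
Qed.

Lemma quotient_gen : (G / H)%g = <<[set a in [seq coset H u | u <- us]]>>%g.
Proof.
apply/eqP; rewrite eqEsubset; apply/andP; split.
  apply/subsetP => a; rewrite quotient_words => /mapP[w _ ->].
  exact: coset_word_gen.
rewrite gen_subG; apply/subsetP => a; rewrite inE => /mapP[u uus ->].
by rewrite mem_quotient // us_G.
Qed.

Lemma card_quotient_words :
  uniq [seq coset H (word w) | w <- ws] -> #|(G / H)%g| = size ws.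
Proof.
by move/card_uniqP; rewrite size_map => <-; apply: eq_card quotient_words.
Qed.

(** Exponents up to n suffice: the exponent n shows that the order divides n, so the order is itself
    among the tested exponents and is therefore a multiple of n. *)
Lemma order_word i n : (0 < n)%N ->
  (forall k, (0 < k <= n)%N ->
     coset H (word (nseq k i)) = coset H (word [::]) <-> (n %| k)%N) ->
  #[coset H (nth 1%g us i)]%g = n.
Proof.
move=> n0 word1; set a := coset _ _.
have ak k : (0 < k <= n)%N -> (a ^+ k)%g = 1%g <-> (n %| k)%N.
  move=> /word1 <-; rewrite /word big_nseq big_nil (coset_id (group1 H)).
  by rewrite -Monoid.iteropE -/(natexp _ _) morphX ?normH.
have a_n : (#[a]%g %| n)%N by rewrite order_dvdn; apply/eqP/ak; rewrite ?n0 /=.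
apply/eqP; rewrite eqn_dvd a_n /=; apply/ak; last exact: expg_order.
by rewrite order_gt0 dvdn_leq.
Qed.

End Words.

(** * Classes of matrices modulo scalars *)

Section ScalarQuotient.

Variable K : finFieldType.
Implicit Types u v : {'GL_4[K]}.

Lemma mem_norm_scalarGL u : u \in 'N(scalarGL K)%g.
Proof. by apply: (subsetP (norm_scalarGL [set u])); rewrite inE. Qed.

(** Equality of classes means that v u^-1 is scalar. The factor is automatically nonzero, since [v]
    is invertible. *)
Lemma coset_scalarGL u v :
  coset (scalarGL K) u = coset (scalarGL K) v <-> exists a, GLval v = a *: GLval u.
Proof.
apply: (iff_trans (coset_eqP mem_norm_scalarGL u v)); rewrite inE.
have vE : GLval v = GLval (v * u^-1)%g *m GLval u.
  by apply: etrans (GL_MxE _ _); rewrite mulgKV.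
split=> [/existsP[a /eqP vu]|[a vu]].
  by exists a; rewrite vE vu mul_scalar_mx.
apply/existsP; exists a; apply/eqP; apply: (etrans (GL_MxE _ _)).
rewrite vu -scalemxAl -[in RHS]scalemx1; congr (_ *: _).
by apply: (etrans (esym (GL_MxE _ _))); rewrite mulgV; apply: GL_1E.
Qed.

End ScalarQuotient.

Definition distinct (gs : seq (seq (seq Z))) (ws : seq (seq nat)) : bool :=
  pairwise (fun A B => ~~ propcols A B) [seq wordcols gs w | w <- ws].

Definition has_order (gs : seq (seq (seq Z))) (i n : nat) : bool :=
  (0 < n)%N &&
  all (fun k => propcols (wordcols gs (nseq k i)) idcols == (n %| k)%N) (iota 1 n).

(** * The automorphism group of one curve from the computed tests *)

Section Curve.

Variables (s : cform) (gs : seq (seq (seq Z))) (us : seq {'GL_4[F11]}).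
Variable ws : seq (seq nat).
Hypothesis us_GK : {in us, forall u, u \in GK QN1 (cubic_mpoly s)}.
Hypothesis usE : forall i, GLval (nth 1%g us i) = mxcols (nth idcols gs i).
Let S := scalarGL F11.

Lemma GLval_word w : GLval (word us w) = mxcols (wordcols gs w).
Proof.
rewrite /word; elim: w => [|i w IHw]; first by rewrite big_nil GL_1E mxcols_one.
rewrite big_cons; apply: etrans (GL_MxE _ _) _; rewrite IHw usE.
by rewrite mxcols_mul.
Qed.

Lemma eq_coset_word w1 w2 :
  coset S (word us w1) = coset S (word us w2) <->
  propcols (wordcols gs w1) (wordcols gs w2).
Proof.
apply: (iff_trans (coset_scalarGL _ _)); rewrite !GLval_word.
by split=> [wE|/propcolsP //]; exact/propcolsP.
Qed.

Hypothesis complete_ws : complete s gs ws.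

(** A suitable multiple of [u] has r = 1, so the search meets its columns and finds them
    proportional to a word; neither scaling changes the class. *)
Lemma GK_word u : u \in GK_QN1_group (cubic_mpoly s) ->
  exists2 w, w \in ws & coset S u = coset S (word us w).
Proof.
case/GK_autom => c autc.
have /hasP[_ /mapP[w ws_w ->]] := searchP complete_ws (colsof_vecs _) autc.
move=> /propcolsP[d]; rewrite colsofK scalerA => wE; exists w => //.
by apply/coset_scalarGL; exists (d * c); rewrite GLval_word.
Qed.

Lemma AutK_gen :
  AutK QN1 (cubic_mpoly s) = <<[set a in [seq coset S u | u <- us]]>>%g.
Proof. exact: (quotient_gen (@mem_norm_scalarGL _) us_GK GK_word). Qed.

Lemma card_AutK : distinct gs ws -> #|AutK QN1 (cubic_mpoly s)| = size ws.
Proof.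
move=> dist; refine (card_quotient_words us_GK GK_word _).
rewrite uniq_pairwise pairwise_map; move: dist; rewrite /distinct pairwise_map.
by apply: sub_pairwise => w1 w2 /=; apply: contraNN => /eqP/eq_coset_word.
Qed.

Lemma order_coset i n : has_order gs i n -> #[coset S (nth 1%g us i)]%g = n.
Proof.
move=> /andP[n0 /allP ok].
have ordE := @order_word _ (scalarGL_group F11) us (@mem_norm_scalarGL F11) i n n0.
(* Unifying ordE with the goal in one go unfolds the group structure of 'GL_4
   and does not terminate in practice. *)
set u := nth 1%g us i; set u' := nth _ us i in ordE; have uE : u' = u by [].
set a := coset S u; set a' := coset _ u' in ordE.
have <- : a' = a by rewrite /a' uE.
apply: ordE => k /andP[k0 kn].
have := ok k; rewrite mem_iota k0 add1n ltnS => /(_ kn)/eqP <-.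
exact: (eq_coset_word (nseq k i) [::]).
Qed.

End Curve.

Section Generators.

Variables (s : cform) (ws : seq (seq nat)).

(** The tests are gathered in one boolean, so that a single [vm_compute] settles a curve. *)
Lemma one_generator A h :
  [&& invariant_cols s A h, complete s [:: A] ws & distinct [:: A] ws] ->
  exists a, [/\ represents QN1 (cubic_mpoly s) (mxcols A) a,
      #|AutK QN1 (cubic_mpoly s)| = size ws
    & AutK QN1 (cubic_mpoly s) = <[a]>%g].
Proof.
move=> /and3P[/invariant_cols_GK[u uGK uE] compl dist].
have us_GK : {in [:: u], forall t, t \in GK QN1 (cubic_mpoly s)}.
  by move=> t; rewrite inE => /eqP ->.
have usE i : GLval (nth 1%g [:: u] i) = mxcols (nth idcols [:: A] i).
  case: i => [|i]; first exact: uE.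
  by rewrite !nth_default // GL_1E mxcols_one.
exists (coset (scalarGL F11) u); split; first by exists u.
  exact: (card_AutK us_GK usE compl dist).
rewrite (AutK_gen us_GK usE compl); congr (<<_>>%g).
by apply/setP => a; rewrite !inE.
Qed.

Lemma two_generators A hA m B hB n :
  [&& invariant_cols s A hA, invariant_cols s B hB, complete s [:: A; B] ws,
      distinct [:: A; B] ws, has_order [:: A; B] 0 m & has_order [:: A; B] 1 n] ->
  exists a b, [/\ represents QN1 (cubic_mpoly s) (mxcols A) a,
    represents QN1 (cubic_mpoly s) (mxcols B) b,
    #|AutK QN1 (cubic_mpoly s)| = size ws,
    AutK QN1 (cubic_mpoly s) = <<[set a; b]>>%g & #[a]%g = m /\ #[b]%g = n].
Proof.
move=> /and3P[/invariant_cols_GK[u uGK uE] /invariant_cols_GK[v vGK vE]].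
move=> /and4P[compl dist ordA ordB].
have us_GK : {in [:: u; v], forall t, t \in GK QN1 (cubic_mpoly s)}.
  by move=> t; rewrite in_cons mem_seq1 => /orP[]/eqP ->.
have usE i : GLval (nth 1%g [:: u; v] i) = mxcols (nth idcols [:: A; B] i).
  case: i => [|[|i]]; [exact: uE | exact: vE |].
  by rewrite !nth_default // GL_1E mxcols_one.
exists (coset (scalarGL F11) u), (coset (scalarGL F11) v).
split; [by exists u | by exists v | exact: (card_AutK us_GK usE compl dist) | |].
  rewrite (AutK_gen us_GK usE compl); congr (<<_>>%g).
  by apply/setP => a; rewrite !inE.
by split; [exact: (order_coset usE ordA) | exact: (order_coset usE ordB)].
Qed.

End Generators.

(** Turns constant polynomials into natural multiples of 1, so that [ring] can match them with the
    numerals in the given cubic forms. *)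
Lemma mpolyC_zF (p : positive) : (zF (Zpos p))%:MP_[4] = (Pos.to_nat p)%:R.
Proof. exact: mpolyC_nat. Qed.

(** * The eight curves *)

Definition cf1 : cform :=
  [:: mon 1 0 0 1; mon 1 0 0 2; mon 2 1 1 2; mon 5 1 1 3; mon 9 1 2 2;
      mon 1 1 2 3; mon 4 2 2 2; mon 3 2 2 3; mon 10 2 3 3; mon 1 3 3 3].

Lemma PN1_1E : PN1_1 = cubic_mpoly cf1.
Proof. by rewrite /PN1_1 /cubic_mpoly /= !mpolyC_zF /Pos.to_nat /=; ring. Qed.

Definition cf2 : cform :=
  [:: mon 1 0 0 1; mon 1 0 0 2; mon 1 1 1 1; mon 1 1 1 2; mon 7 1 2 2;
      mon 4 1 3 3; mon 2 2 2 2; mon 9 2 3 3].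

Lemma PN1_2E : PN1_2 = cubic_mpoly cf2.
Proof. by rewrite /PN1_2 /cubic_mpoly /= !mpolyC_zF /Pos.to_nat /=; ring. Qed.

Definition cf3 : cform :=
  [:: mon 1 0 0 1; mon 1 0 0 2; mon 1 1 1 1; mon 8 1 1 2; mon 3 1 2 2;
      mon 10 1 3 3; mon 10 2 2 2; mon 10 2 3 3].

Lemma PN1_3E : PN1_3 = cubic_mpoly cf3.
Proof. by rewrite /PN1_3 /cubic_mpoly /= !mpolyC_zF /Pos.to_nat /=; ring. Qed.

Definition cf4 : cform :=
  [:: mon 1 0 0 1; mon 1 0 0 2; mon 1 1 1 1; mon 9 1 1 2; mon 2 1 1 3;
      mon 3 1 2 2; mon 3 1 2 3; mon 4 1 3 3; mon 10 2 2 2; mon 2 2 2 3;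
      mon 6 2 3 3].

Lemma PN1_4E : PN1_4 = cubic_mpoly cf4.
Proof. by rewrite /PN1_4 /cubic_mpoly /= !mpolyC_zF /Pos.to_nat /=; ring. Qed.

Definition cf5 : cform :=
  [:: mon 1 0 0 1; mon 1 0 0 2; mon 1 0 2 2; mon 10 1 1 3; mon 9 1 2 2;
      mon 9 1 3 3; mon 8 2 2 2; mon 8 2 2 3; mon 8 2 3 3; mon 3 3 3 3].

Lemma PN1_5E : PN1_5 = cubic_mpoly cf5.
Proof. by rewrite /PN1_5 /cubic_mpoly /= !mpolyC_zF /Pos.to_nat /=; ring. Qed.

Definition cf6 : cform :=
  [:: mon 1 0 0 1; mon 1 0 0 2; mon 1 0 2 2; mon 9 1 1 2; mon 5 1 1 3;
      mon 1 1 2 3; mon 8 1 3 3; mon 3 2 2 2; mon 9 2 2 3; mon 2 2 3 3;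
      mon 5 3 3 3].

Lemma PN1_6E : PN1_6 = cubic_mpoly cf6.
Proof. by rewrite /PN1_6 /cubic_mpoly /= !mpolyC_zF /Pos.to_nat /=; ring. Qed.

Definition cf7 : cform :=
  [:: mon 1 0 0 1; mon 1 0 0 2; mon 1 0 2 2; mon 4 1 1 1; mon 2 1 1 2;
      mon 10 1 1 3; mon 3 1 2 2; mon 8 1 2 3; mon 8 1 3 3; mon 8 2 2 2;
      mon 7 2 2 3; mon 7 2 3 3; mon 4 3 3 3].

Lemma PN1_7E : PN1_7 = cubic_mpoly cf7.
Proof. by rewrite /PN1_7 /cubic_mpoly /= !mpolyC_zF /Pos.to_nat /=; ring. Qed.

Definition cf8 : cform :=
  [:: mon 1 0 0 1; mon 1 0 0 2; mon 1 0 2 2; mon 9 1 1 1; mon 6 1 1 2;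
      mon 5 1 1 3; mon 8 1 2 2; mon 5 1 2 3; mon 2 1 3 3; mon 1 2 2 2;
      mon 2 2 2 3; mon 7 2 3 3; mon 1 3 3 3].

Lemma PN1_8E : PN1_8 = cubic_mpoly cf8.
Proof. by rewrite /PN1_8 /cubic_mpoly /= !mpolyC_zF /Pos.to_nat /=; ring. Qed.

(** The theorem lists matrices by rows, the search by columns. *)
Lemma mx4_cols (t : seq (seq F11)) (A : seq (seq Z)) :
  all (fun i => all (fun j => (nth [::] t i)`_j == zF (nth Z0 (nth [::] A j) i))
                    (iota 0 4)) (iota 0 4) ->
  mx4 t = mxcols A.
Proof.
move=> /allP tA; apply/matrixP => i j; rewrite !mxE.
have /tA/allP/(_ j) : (i : nat) \in iota 0 4 by rewrite in_iota4.
by rewrite in_iota4 => /(_ (ltn_ord j))/eqP.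
Qed.

Lemma diag4_cols : diag4 [:: -1; 1; 1; -1] =
  mxcols [:: [:: 10; 0; 0; 0]; [:: 0; 1; 0; 0]; [:: 0; 0; 1; 0]; [:: 0; 0; 0; 10]]%BZ.
Proof.
apply/matrixP => i j; rewrite !mxE.
by case: i => [[|[|[|[|i]]]] i4]; case: j => [[|[|[|[|j]]]] j4] //; apply/val_inj.
Qed.

Lemma aut_cf1 :
  exists a, [/\ represents QN1 (cubic_mpoly cf1)
      (mxcols [:: [:: 2; 3; 7; 6]; [:: 4; 6; 7; 6]; [:: 5; 5; 1; 10]; [:: 1; 1; 10; 1]]%BZ) a,
    #|AutK QN1 (cubic_mpoly cf1)| = 6%N & AutK QN1 (cubic_mpoly cf1) = <[a]>%g].
Proof.
(* The words are the powers a^0, ..., a^5; the last list holds the coefficients of the linear form l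
   with g . P = P + l Q. The other curves follow the same pattern. *)
apply: (@one_generator _ [seq nseq k 0%N | k <- iota 0 6] _ [:: 2; 7; 5; 5]%BZ).
by vm_compute.
Qed.

Lemma aut_cf2 :
  exists a, [/\ represents QN1 (cubic_mpoly cf2)
      (mxcols [:: [:: 10; 0; 0; 0]; [:: 0; 1; 0; 0]; [:: 0; 0; 1; 0]; [:: 0; 0; 0; 10]]%BZ) a,
    #|AutK QN1 (cubic_mpoly cf2)| = 2%N & AutK QN1 (cubic_mpoly cf2) = <[a]>%g].
Proof.
(* Here x and w occur in P only through their squares, so P is fixed exactly and l = 0. *)
apply: (@one_generator _ [seq nseq k 0%N | k <- iota 0 2] _ [:: 0; 0; 0; 0]%BZ).
by vm_compute.
Qed.

Lemma aut_cf3 :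
  exists a b, [/\ represents QN1 (cubic_mpoly cf3)
      (mxcols [:: [:: 5; 5; 5; 6]; [:: 6; 6; 5; 6]; [:: 6; 5; 6; 6]; [:: 6; 5; 5; 5]]%BZ) a,
    represents QN1 (cubic_mpoly cf3)
      (mxcols [:: [:: 10; 0; 0; 0]; [:: 0; 1; 0; 0]; [:: 0; 0; 1; 0]; [:: 0; 0; 0; 10]]%BZ) b,
    #|AutK QN1 (cubic_mpoly cf3)| = 8%N, AutK QN1 (cubic_mpoly cf3) = <<[set a; b]>>%g
    & #[a]%g = 4%N /\ #[b]%g = 2%N].
Proof.
(* One word per class, by increasing length. Both ab and ba occur, and b differs from a^2: the group
   is dihedral of order 8. *)
apply: (@two_generators _
  [:: [::]; [:: 0]; [:: 1]; [:: 0; 0]; [:: 0; 1]; [:: 1; 0]; [:: 0; 0; 0];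
      [:: 0; 0; 1]]%N
  _ [:: 0; 0; 0; 0]%BZ _ _ [:: 0; 0; 0; 0]%BZ).
by vm_compute.
Qed.

Lemma aut_cf4 :
  exists a, [/\ represents QN1 (cubic_mpoly cf4)
      (mxcols [:: [:: 10; 10; 2; 9]; [:: 6; 1; 10; 2]; [:: 6; 6; 1; 10]; [:: 3; 6; 6; 10]]%BZ) a,
    #|AutK QN1 (cubic_mpoly cf4)| = 2%N & AutK QN1 (cubic_mpoly cf4) = <[a]>%g].
Proof.
apply: (@one_generator _ [seq nseq k 0%N | k <- iota 0 2] _ [:: 9; 0; 1; 1]%BZ).
by vm_compute.
Qed.

Lemma aut_cf5 :
  exists a, [/\ represents QN1 (cubic_mpoly cf5)
      (mxcols [:: [:: 5; 8; 10; 6]; [:: 7; 7; 3; 8]; [:: 3; 7; 0; 0]; [:: 9; 9; 0; 0]]%BZ) a,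
    #|AutK QN1 (cubic_mpoly cf5)| = 3%N & AutK QN1 (cubic_mpoly cf5) = <[a]>%g].
Proof.
apply: (@one_generator _ [seq nseq k 0%N | k <- iota 0 3] _ [:: 8; 9; 8; 0]%BZ).
by vm_compute.
Qed.

Lemma aut_cf6 :
  exists a b, [/\ represents QN1 (cubic_mpoly cf6)
      (mxcols [:: [:: 2; 1; 5; 3]; [:: 3; 9; 2; 5]; [:: 10; 5; 9; 1]; [:: 7; 10; 3; 2]]%BZ) a,
    represents QN1 (cubic_mpoly cf6)
      (mxcols [:: [:: 1; 0; 0; 0]; [:: 5; 0; 1; 0]; [:: 6; 1; 0; 0]; [:: 3; 6; 5; 1]]%BZ) b,
    #|AutK QN1 (cubic_mpoly cf6)| = 4%N, AutK QN1 (cubic_mpoly cf6) = <<[set a; b]>>%g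
    & #[a]%g = 2%N /\ #[b]%g = 2%N].
Proof.
(* The words 1, a, b, ab exhaust a Klein four-group. *)
apply: (@two_generators _
  [:: [::]; [:: 0]; [:: 1]; [:: 0; 1]]%N
  _ [:: 9; 1; 6; 10]%BZ _ _ [:: 0; 8; 3; 7]%BZ).
by vm_compute.
Qed.

Lemma aut_cf7 :
  exists a b, [/\ represents QN1 (cubic_mpoly cf7)
      (mxcols [:: [:: 6; 1; 5; 1]; [:: 3; 6; 3; 5]; [:: 5; 1; 6; 1]; [:: 3; 5; 3; 6]]%BZ) a,
    represents QN1 (cubic_mpoly cf7)
      (mxcols [:: [:: 0; 0; 1; 6]; [:: 6; 8; 0; 0]; [:: 0; 0; 2; 3]; [:: 10; 7; 0; 0]]%BZ) b,
    #|AutK QN1 (cubic_mpoly cf7)| = 12%N, AutK QN1 (cubic_mpoly cf7) = <<[set a; b]>>%g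
    & #[a]%g = 2%N /\ #[b]%g = 6%N].
Proof.
(* Again ab and ba are both listed, and a differs from b^3, the involution among the powers of b:
   the group is dihedral of order 12. *)
apply: (@two_generators _
  [:: [::]; [:: 0]; [:: 1]; [:: 0; 1]; [:: 1; 0]; [:: 1; 1]; [:: 0; 1; 0];
      [:: 0; 1; 1]; [:: 1; 1; 0]; [:: 1; 1; 1]; [:: 0; 1; 1; 0];
      [:: 0; 1; 1; 1]]%N
  _ [:: 7; 2; 7; 2]%BZ _ _ [:: 9; 1; 5; 7]%BZ).
by vm_compute.
Qed.

Lemma aut_cf8 :
  exists a b, [/\ represents QN1 (cubic_mpoly cf8)
      (mxcols [:: [:: 0; 7; 0; 2]; [:: 0; 6; 0; 6]; [:: 5; 9; 8; 1]; [:: 2; 8; 9; 8]]%BZ) a,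
    represents QN1 (cubic_mpoly cf8)
      (mxcols [:: [:: 9; 1; 8; 4]; [:: 5; 3; 5; 8]; [:: 2; 3; 3; 1]; [:: 5; 2; 5; 9]]%BZ) b,
    #|AutK QN1 (cubic_mpoly cf8)| = 24%N, AutK QN1 (cubic_mpoly cf8) = <<[set a; b]>>%g
    & #[a]%g = 4%N /\ #[b]%g = 2%N].
Proof.
(* One word for each of the 24 classes, by increasing length, followed by the linear forms of the
   two generators. *)
apply: (@two_generators _
  [:: [::]; [:: 0]; [:: 1]; [:: 0; 0]; [:: 0; 1]; [:: 1; 0]; [:: 0; 0; 0];
      [:: 0; 0; 1]; [:: 0; 1; 0]; [:: 1; 0; 0]; [:: 1; 0; 1]; [:: 0; 0; 0; 1];
      [:: 0; 0; 1; 0]; [:: 0; 1; 0; 0]; [:: 0; 1; 0; 1]; [:: 1; 0; 0; 1];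
      [:: 0; 0; 0; 1; 0]; [:: 0; 0; 1; 0; 0]; [:: 0; 0; 1; 0; 1];
      [:: 0; 1; 0; 0; 1]; [:: 1; 0; 0; 1; 0]; [:: 0; 0; 0; 1; 0; 0];
      [:: 0; 0; 0; 1; 0; 1]; [:: 0; 0; 1; 0; 0; 1]]%N
  _ [:: 1; 4; 10; 0]%BZ _ _ [:: 1; 2; 3; 2]%BZ).
by vm_compute.
Qed.

Theorem proposition4p3p1 :
  (exists a : coset_of (scalarGL F11),
     [/\ represents QN1 PN1_1
          (mx4 [:: [:: 2; 4; 5; 1];
            [:: 3; 6; 5; 1];
            [:: 7; 7; 1; 10];
            [:: 6; 6; 10; 1]]) a,
        #|AutK QN1 PN1_1| = 6%N
      & AutK QN1 PN1_1 = <[a]>%g]) /\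
  (exists a : coset_of (scalarGL F11),
     [/\ represents QN1 PN1_2
          (diag4 [:: -1; 1; 1; -1]) a,
        #|AutK QN1 PN1_2| = 2%N
      & AutK QN1 PN1_2 = <[a]>%g]) /\
  (exists a b : coset_of (scalarGL F11),
     [/\ represents QN1 PN1_3
          (mx4 [:: [:: 5; 6; 6; 6];
            [:: 5; 6; 5; 5];
            [:: 5; 5; 6; 5];
            [:: 6; 6; 6; 5]]) a,
        represents QN1 PN1_3
          (diag4 [:: -1; 1; 1; -1]) b,
        #|AutK QN1 PN1_3| = 8%N,
        AutK QN1 PN1_3 = <<[set a; b]>>%g
      & (#[a]%g = 4%N) /\ (#[b]%g = 2%N)]) /\
  (exists a : coset_of (scalarGL F11),
     [/\ represents QN1 PN1_4
          (mx4 [:: [:: 10; 6; 6; 3];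
            [:: 10; 1; 6; 6];
            [:: 2; 10; 1; 6];
            [:: 9; 2; 10; 10]]) a,
        #|AutK QN1 PN1_4| = 2%N
      & AutK QN1 PN1_4 = <[a]>%g]) /\
  (exists a : coset_of (scalarGL F11),
     [/\ represents QN1 PN1_5
          (mx4 [:: [:: 5; 7; 3; 9];
            [:: 8; 7; 7; 9];
            [:: 10; 3; 0; 0];
            [:: 6; 8; 0; 0]]) a,
        #|AutK QN1 PN1_5| = 3%N
      & AutK QN1 PN1_5 = <[a]>%g]) /\
  (exists a b : coset_of (scalarGL F11),
     [/\ represents QN1 PN1_6
          (mx4 [:: [:: 2; 3; 10; 7];
            [:: 1; 9; 5; 10];
            [:: 5; 2; 9; 3];
            [:: 3; 5; 1; 2]]) a,
        represents QN1 PN1_6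
          (mx4 [:: [:: 1; 5; 6; 3];
            [:: 0; 0; 1; 6];
            [:: 0; 1; 0; 5];
            [:: 0; 0; 0; 1]]) b,
        #|AutK QN1 PN1_6| = 4%N,
        AutK QN1 PN1_6 = <<[set a; b]>>%g
      & (#[a]%g = 2%N) /\ (#[b]%g = 2%N)]) /\
  (exists a b : coset_of (scalarGL F11),
     [/\ represents QN1 PN1_7
          (mx4 [:: [:: 6; 3; 5; 3];
            [:: 1; 6; 1; 5];
            [:: 5; 3; 6; 3];
            [:: 1; 5; 1; 6]]) a,
        represents QN1 PN1_7
          (mx4 [:: [:: 0; 6; 0; 10];
            [:: 0; 8; 0; 7];
            [:: 1; 0; 2; 0];
            [:: 6; 0; 3; 0]]) b,
        #|AutK QN1 PN1_7| = 12%N,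
        AutK QN1 PN1_7 = <<[set a; b]>>%g
      & (#[a]%g = 2%N) /\ (#[b]%g = 6%N)]) /\
  (exists a b : coset_of (scalarGL F11),
     [/\ represents QN1 PN1_8
          (mx4 [:: [:: 0; 0; 5; 2];
            [:: 7; 6; 9; 8];
            [:: 0; 0; 8; 9];
            [:: 2; 6; 1; 8]]) a,
        represents QN1 PN1_8
          (mx4 [:: [:: 9; 5; 2; 5];
            [:: 1; 3; 3; 2];
            [:: 8; 5; 3; 5];
            [:: 4; 8; 1; 9]]) b,
        #|AutK QN1 PN1_8| = 24%N,
        AutK QN1 PN1_8 = <<[set a; b]>>%g
      & (#[a]%g = 4%N) /\ (#[b]%g = 2%N)]).
Proof.
split; first by rewrite PN1_1E;
    rewrite (@mx4_cols _
      [:: [:: 2; 3; 7; 6]; [:: 4; 6; 7; 6]; [:: 5; 5; 1; 10]; [:: 1; 1; 10; 1]]%BZ) //;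
    exact: aut_cf1.
split; first by rewrite PN1_2E;
    rewrite diag4_cols;
    exact: aut_cf2.
split; first by rewrite PN1_3E;
    rewrite (@mx4_cols _
      [:: [:: 5; 5; 5; 6]; [:: 6; 6; 5; 6]; [:: 6; 5; 6; 6]; [:: 6; 5; 5; 5]]%BZ) //;
    rewrite diag4_cols;
    exact: aut_cf3.
split; first by rewrite PN1_4E;
    rewrite (@mx4_cols _
      [:: [:: 10; 10; 2; 9]; [:: 6; 1; 10; 2]; [:: 6; 6; 1; 10]; [:: 3; 6; 6; 10]]%BZ) //;
    exact: aut_cf4.
split; first by rewrite PN1_5E;
    rewrite (@mx4_cols _
      [:: [:: 5; 8; 10; 6]; [:: 7; 7; 3; 8]; [:: 3; 7; 0; 0]; [:: 9; 9; 0; 0]]%BZ) //;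
    exact: aut_cf5.
split; first by rewrite PN1_6E;
    rewrite (@mx4_cols _
      [:: [:: 2; 1; 5; 3]; [:: 3; 9; 2; 5]; [:: 10; 5; 9; 1]; [:: 7; 10; 3; 2]]%BZ) //;
    rewrite (@mx4_cols _
      [:: [:: 1; 0; 0; 0]; [:: 5; 0; 1; 0]; [:: 6; 1; 0; 0]; [:: 3; 6; 5; 1]]%BZ) //;
    exact: aut_cf6.
split; first by rewrite PN1_7E;
    rewrite (@mx4_cols _
      [:: [:: 6; 1; 5; 1]; [:: 3; 6; 3; 5]; [:: 5; 1; 6; 1]; [:: 3; 5; 3; 6]]%BZ) //;
    rewrite (@mx4_cols _
      [:: [:: 0; 0; 1; 6]; [:: 6; 8; 0; 0]; [:: 0; 0; 2; 3]; [:: 10; 7; 0; 0]]%BZ) //;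
    exact: aut_cf7.
by rewrite PN1_8E;
    rewrite (@mx4_cols _
      [:: [:: 0; 7; 0; 2]; [:: 0; 6; 0; 6]; [:: 5; 9; 8; 1]; [:: 2; 8; 9; 8]]%BZ) //;
    rewrite (@mx4_cols _
      [:: [:: 9; 1; 8; 4]; [:: 5; 3; 5; 8]; [:: 2; 3; 3; 1]; [:: 5; 2; 5; 9]]%BZ) //;
    exact: aut_cf8.
Qed.
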